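(* For every $n\in\mathbb{N}\setminus\{1\}$, there exists some finite group $G$ such that $\mathrm{minmaxl}(G)-\mathrm{chiefl}(G)=n$.
   Context: $\mathbb{N}$ denotes the set of positive integers, so the claim concerns all integers $n\ge 2$. For a finite group $G$, $\mathcal{L}(G)$ denotes the lattice of all subgroups of $G$ ordered by inclusion. A chain in $\mathcal{L}(G)$ is a subset totally ordered by inclusion; it is maximal if it is not properly contained in any other chain (so a maximal chain contains $1$ and $G$). The length of a chain is its number of elements minus one. $\mathrm{minmaxl}(G)$ is the minimum length of a maximal chain in $\mathcal{L}(G)$. $\mathrm{chiefl}(G)$ is the length of a chief series of $G$, i.e. of a chain $1=N_0<N_1<\dots<N_r=G$ of normal subgroups of $G$ that cannot be refined by inserting further normal subgroups of $G$ (its length is $r$, which is independent of the chief series). *)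

(* Defs.v *)
From mathcomp Require Import all_boot all_order all_algebra.
From mathcomp Require Import all_fingroup all_solvable.

Set Implicit Arguments.
Unset Strict Implicit.
Unset Printing Implicit Defensive.

Import GroupScope.

Section ChainsOfSubgroups.

Variable gT : finGroupType.
Implicit Types (G H K : {group gT}) (C : {set {group gT}}) (s : seq {group gT}).

Definition subgroup_chain G C : bool :=
  (C \subset subgroups G) &&
  [forall H in C, forall K in C, (H \subset K) || (K \subset H)].

Definition maximal_chain G C : bool := maxset (subgroup_chain G) C.

Definition chain_length C : nat := #|C|.-1.

Lemma maximal_chain_length_exists G :
  exists k, [exists C, maximal_chain G C && (chain_length C == k)].
Proof.
have chain0: subgroup_chain G set0.
  by rewrite /subgroup_chain sub0set; apply/forall_inP=> H; rewrite inE.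
have [C maxC _] := maxset_exists chain0.
by exists (chain_length C); apply/existsP; exists C; rewrite /maximal_chain maxC /=.
Qed.

Definition minmaxl G : nat := ex_minn (maximal_chain_length_exists G).

(* The trivial group N_0 is not listed, so that the length is size s.         *)
Definition chief_series G s : Prop :=
  (G.-chief).-series 1%G s /\ last 1%G s = G.

(* The length of some chief series; chieflE shows that the choice of the      *)
(* series is irrelevant.                                                      *)
Definition chiefl G : nat := size (s2val (chief_series_exists (normal_refl G))).

Lemma chief_series_acomps G s :
  chief_series G s ->
  acomps ('J \ subsetT G)%gact G (rev (belast 1%G s)).
Proof.
case=> ch_s lastG; rewrite /acomps; apply/andP; split.
  case: s lastG {ch_s} => [|H s] /=; first by move=> <-.
  by rewrite rev_cons last_rcons.
set e := (X in path X); suff: path e (last 1%G s) (rev (belast 1%G s)).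
  by rewrite lastG.
rewrite rev_path; apply: sub_path ch_s => V U /= /andP[maxV nsUG].
have [/andP[ltVU nVG] maxP] := maxgroupP maxV.
have sVU := proper_sub ltVU.
apply/maxgroupP; split.
  rewrite properE sVU /= in ltVU.
  rewrite /normal sVU ltVU (subset_trans (normal_sub nsUG)) //=.
  by rewrite astabs_ract astabsJ subsetI subxx.
move=> H /and3P[nsHU ltHU]; rewrite astabs_ract astabsJ subsetI subxx /= => nHG.
by apply: maxP; rewrite properE (normal_sub nsHU) ltHU.
Qed.

Lemma chieflE G s : chief_series G s -> chiefl G = size s.
Proof.
rewrite /chiefl => ch_s; case: chief_series_exists => t ch_t lastG /=.
have /chief_series_acomps acT: chief_series G t by split.
have := StrongJordanHolderUniqueness (subsetT G) acT (chief_series_acomps ch_s).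
move/perm_size; rewrite /mkfactors !size_map !size_pairmap.
by rewrite !size_rev !size_belast.
Qed.

End ChainsOfSubgroups.

(* Main.v *)
(* Let T = Alt_5, G_0 = T and G_(k+1) = (T wr C_p) x G_k, where the prime p
   exceeds both |T| and |G_k|.  Each step raises chiefl by 2, the new chief
   factors being T^p and C_p, and minmaxl by 3; since chiefl T = 1 and
   minmaxl T <= 3, some G_k has difference n for every n >= 2.

   Upper bound: let D be the group of constant functions extended by C_p,
   and let f : G_k -> T be onto.  Then (T wr C_p) x G_k, D x G_k,
   diag(T) x G_k and the graph of f are successive maximal subgroups, and
   the graph is isomorphic to G_k.

   Lower bound: along a maximal chain, each step is strict either in
   the image of a morphism or in its kernel, but not in both.  It suffices
   to show that the kernel T^p has an intermediate term, i.e., that no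
   subgroup L above T^p has a maximal subgroup M complementing T^p.  If M
   does not contain C = L n G_k then M C = L, so |T|^p <= |C| <= |G_k| <
   |T|^p.  If M contains C then the projection of M on T wr C_p is a
   p-group, hence by Sylow a conjugate of it lies in D, which meets T^p; so
   M is not maximal. *)
From HB Require Import structures.
Require Import Defs.
From mathcomp Require Import all_boot all_order all_algebra.
From mathcomp Require Import all_fingroup all_solvable.

Set Implicit Arguments.
Unset Strict Implicit.
Unset Printing Implicit Defensive.

Import GroupScope.

(** * Maximal chains as towers of successive maximal subgroups *)

(** An inductive form of maximal chains that can be followed step by step; [minmaxl G] is the least
    [l] with [unrefinable G l]. *)
Inductive unrefinable (gT : finGroupType) : {group gT} -> nat -> Prop :=
| unrefinable1 : unrefinable 1%G 0
| unrefinableS (M G : {group gT}) l of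
    maximal M G & unrefinable M l : unrefinable G l.+1.

Section MaximalChains.

Variable gT : finGroupType.
Implicit Types (G H K L M : {group gT}) (C B : {set {group gT}}).

Lemma subgroup_chainP G C :
  reflect ((forall H, H \in C -> H \subset G) /\
           {in C &, forall H K, (H \subset K) || (K \subset H)})
          (subgroup_chain G C).
Proof.
apply: (iffP andP) => [[/subsetP sCG /forall_inP cC]|[sCG cC]]; split.
- by move=> H /sCG; rewrite inE.
- by move=> H K HC KC; move/forall_inP: (cC H HC); apply.
- by apply/subsetP=> H /sCG; rewrite inE.
- by apply/forall_inP=> H HC; apply/forall_inP=> K; apply: cC.
Qed.

(** Otherwise adding [L] to [C] would give a strictly larger chain. *)
Lemma mem_maximal_chain G C L :
    maximal_chain G C -> L \subset G ->
    {in C, forall H, (H \subset L) || (L \subset H)} ->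
  L \in C.
Proof.
case/maxsetP=> /subgroup_chainP[sCG cC] maxC sLG cL.
rewrite -[C](maxC (L |: C)) ?setU11 ?subsetUr //.
apply/subgroup_chainP; split=> [H|H K].
  by case/setU1P=> [->|/sCG].
case/setU1P=> [->|HC]; case/setU1P=> [->|KC]; rewrite ?subxx //; last exact: cC.
  by rewrite orbC cL.
by rewrite cL.
Qed.

Lemma maximal_chain_top G C : maximal_chain G C -> G \in C.
Proof.
move=> maxC; have /maxsetp/subgroup_chainP[sCG _] := maxC.
by apply: mem_maximal_chain maxC _ _ => // H /sCG->.
Qed.

Lemma maximal_chain_bottom G C : maximal_chain G C -> 1%G \in C.
Proof.
move=> maxC; apply: mem_maximal_chain maxC _ _; first exact: sub1G.
by move=> H _; rewrite sub1G orbT.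
Qed.

(** A term of a larger chain is comparable with [M]: below [M] it belongs to [C] because [C] is
    maximal, above [M] it is [M] or [G]. *)
Lemma maximal_chain_add M G C :
  maximal M G -> maximal_chain M C -> maximal_chain G (G |: C).
Proof.
move=> maxM maxC; have /maxsetp/subgroup_chainP[sCM cC] := maxC.
have sMG : M \subset G by apply: proper_sub; apply: maxgroupp maxM.
have MC := maximal_chain_top maxC.
apply/maxsetP; split=> [|B /subgroup_chainP[sBG cB] sCB].
  apply/subgroup_chainP; split=> [H|H K].
    by case/setU1P=> [->//|/sCM/subset_trans->].
  case/setU1P=> [->|HC]; case/setU1P=> [->|KC]; rewrite ?subxx //.
  - by rewrite (subset_trans (sCM K KC)) // orbT.
  - by rewrite (subset_trans (sCM H HC)).
  - exact: cC.
apply/eqP; rewrite eqEsubset sCB andbT; apply/subsetP=> L LB.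
have CB H : H \in C -> H \in B by move=> HC; rewrite (subsetP sCB) ?setU1r.
have [sLM|] := boolP (L \subset M).
  rewrite setU1r //; apply: mem_maximal_chain maxC _ _ => // H HC.
  by rewrite cB // CB.
have := cB L M LB (CB M MC); case: (L \subset M) => //= sML _.
have /maximal_eqP[_ /(_ L sML (sBG L LB))] : maximal_eq M G.
  by rewrite /maximal_eq maxM orbT.
case=> [eLM | eLG]; last by rewrite (_ : L = G) ?setU11 //; apply: val_inj.
by rewrite (_ : L = M) ?setU1r //; apply: val_inj.
Qed.

Lemma unrefinable_maximal_chain G l :
  unrefinable G l -> exists2 C, maximal_chain G C & #|C| = l.+1.
Proof.
elim=> {G l} [|M G l maxM _ [C maxC cardC]].
  exists [set 1%G]; last by rewrite cards1.
  apply/maxsetP; split=> [|B /subgroup_chainP[sB1 _] s1B].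
    by apply/subgroup_chainP; split=> [H|H K] /set1P->; rewrite ?sub1G.
  apply/eqP; rewrite eqEsubset s1B andbT; apply/subsetP=> H /sB1 sH1.
  by rewrite inE -val_eqE eqEsubset sH1 sub1G.
exists (G |: C); first exact: maximal_chain_add maxM maxC.
rewrite cardsU1 cardC (_ : G \notin C) //.
have /maxsetp/subgroup_chainP[sCM _] := maxC.
by apply: contraL (maxgroupp maxM) => /sCM sGM; rewrite properE sGM andbF.
Qed.

(** Induction on the number of terms: the largest term [M] other than [G] is maximal in [G], and
    removing [G] leaves a maximal chain of [M]. *)
Lemma maximal_chain_unrefinable G C :
  maximal_chain G C -> unrefinable G #|C|.-1.
Proof.
have [n] := ubnP #|C|; elim: n => // n IHn in G C * => /ltnSE-leCn maxC.
have /maxsetP[/subgroup_chainP[sCG cC] maxCP] := maxC.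
have GC := maximal_chain_top maxC; have C1 := maximal_chain_bottom maxC.
have [eG1|ntG] := eqVneq G 1%G.
  rewrite eG1 (_ : C = [set 1%G]) ?cards1; first exact: unrefinable1.
  apply/eqP; rewrite eqEsubset sub1set C1 andbT; apply/subsetP=> H /sCG.
  by rewrite eG1 inE -val_eqE eqEsubset sub1G andbT.
have C'1 : 1%G \in C :\ G by rewrite !inE eq_sym ntG.
have [M /setD1P[neMG MC] maxM] :
    exists2 M, M \in C :\ G & forall H, H \in C :\ G -> #|H| <= #|M|.
  by case: (arg_maxnP (fun H : {group gT} => #|H|) C'1) => M CM maxM; exists M.
have sC'M H : H \in C :\ G -> H \subset M.
  move=> C'H; have /setD1P[_ HC] := C'H.
  have /orP[//|sMH] := cC H M HC MC.
  by rewrite (_ : M :=: H) //; apply/eqP; rewrite eqEcard sMH maxM.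
have ltMG : M \proper G by rewrite properEneq sCG // andbT.
rewrite (cardsD1 G) GC /= add1n in leCn *.
have C'gt0 : 0 < #|C :\ G| by apply/card_gt0P; exists 1%G.
rewrite -(prednK C'gt0); apply: (@unrefinableS _ M).
  apply/maxgroupP; split=> // L ltLG sML.
  have LC : L \in C.
    apply: mem_maximal_chain maxC (proper_sub ltLG) _ => H HC.
    have [->|neHG] := eqVneq H G; first by rewrite (proper_sub ltLG) orbT.
    by rewrite (subset_trans (sC'M H _)) // !inE neHG.
  apply/eqP; rewrite eqEsubset sML sC'M // !inE LC andbT.
  by apply: contraTneq ltLG => ->; rewrite properxx.
apply: IHn => //; apply/maxsetP; split=> [|B /subgroup_chainP[sBM cB] sC'B].
  apply/subgroup_chainP; split=> // H K /setD1P[_ HC] /setD1P[_ KC].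
  exact: cC.
have sMG := proper_sub ltMG.
have GnB : G \notin B.
  by apply: contraL ltMG => /sBM sGM; rewrite properE sGM andbF.
rewrite -(maxCP (G |: B)); first by rewrite setU1K.
  apply/subgroup_chainP; split=> [H|H K].
    by case/setU1P=> [->//|/sBM/subset_trans->].
  case/setU1P=> [->|HB]; case/setU1P=> [->|KB]; rewrite ?subxx //.
  - by rewrite (subset_trans (sBM K KB)) // orbT.
  - by rewrite (subset_trans (sBM H HB)).
  - exact: cB.
by rewrite -(setD1K GC) setUS.
Qed.

Lemma minmaxl_unrefinable G : unrefinable G (minmaxl G).
Proof.
rewrite /minmaxl; case: ex_minnP => k /existsP[C /andP[maxC /eqP <-]] _.
exact: maximal_chain_unrefinable.
Qed.

Lemma minmaxl_min G l : unrefinable G l -> minmaxl G <= l.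
Proof.
case/unrefinable_maximal_chain=> C maxC cardC.
rewrite /minmaxl; case: ex_minnP => k _; apply.
by apply/existsP; exists C; rewrite maxC /chain_length cardC /=.
Qed.

End MaximalChains.

(** * Unrefinable chains under morphisms *)

(** One factor normalises the other, so the product is a subgroup, and it strictly contains the
    maximal subgroup [M]. *)
Lemma maximal_mulg (gT : finGroupType) (M H K : {group gT}) :
    maximal M H -> K \subset H -> K \subset 'N(M) \/ M \subset 'N(K) ->
    ~~ (K \subset M) ->
  M * K = H.
Proof.
move=> maxM sKH nKM nsKM; have sMH := proper_sub (maxgroupp maxM).
have -> : M * K = M <*> K by case: nKM => [/norm_joinEr|/norm_joinEl].
have /maximal_eqP[_ /(_ (M <*> K)%G)] : maximal_eq M H.
  by rewrite /maximal_eq maxM orbT.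
rewrite joing_subl join_subG sMH sKH /= => -[//|//|eMK|//].
by rewrite -eMK joing_subr in nsKM.
Qed.

Section MorphismJumps.

Variables (aT rT : finGroupType) (D : {group aT}) (f : {morphism D >-> rT}).
Implicit Types H M : {group aT}.

Lemma morphim_maximal_ker H M :
    H \subset D -> maximal M H -> 'ker_H f \subset M ->
  maximal (f @* M) (f @* H).
Proof.
move=> sHD maxM sKM; have sMH := proper_sub (maxgroupp maxM).
pose g := [morphism of restrm sHD f].
have gE (K : {group aT}) : K \subset H -> f @* K = g @* K.
  by move=> sKH; rewrite morphim_restrm (setIidPr sKH).
rewrite !gE // -(morphpre_maximal (f := g)) ?morphimS //.
  by rewrite !morphimGK // ?ker_restrm // subsetIl.
Qed.

(** [H] is the product of [M] and its part of the kernel, so this step of a chain disappears in the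
    image. *)
Lemma morphim_maximal_mulker H M :
    H \subset D -> maximal M H -> ~~ ('ker_H f \subset M) ->
  f @* M = f @* H.
Proof.
move=> sHD maxM nsKM; have sMH := proper_sub (maxgroupp maxM).
have nKM : M \subset 'N('ker_H f).
  rewrite (subset_trans sMH) // normsI ?normG // (subset_trans sHD) //.
  exact: ker_norm.
rewrite -(maximal_mulg maxM (subsetIl _ _) (or_intror nKM) nsKM).
rewrite morphimMl ?(subset_trans sMH) //.
rewrite (_ : f @* 'ker_H f = 1) ?mulg1 //.
by apply/trivgP; rewrite -(morphim_ker f) morphimS // subsetIr.
Qed.

(** The image of a chain, repetitions removed, is again unrefinable. If the kernel meets [H]
    nontrivially, some step has to cut it down, and that step is lost in the image. *)
Lemma unrefinable_morphim H l :
    unrefinable H l -> H \subset D ->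
  exists2 a, unrefinable (f @* H) a & a + ('ker_H f != 1) <= l.
Proof.
elim=> {H l} [|M H l maxM _ IH] sHD.
  exists 0; last by rewrite (trivgP (subsetIl _ _)) eqxx.
  by rewrite (_ : (f @* 1)%G = 1%G); [constructor | apply/val_inj/morphim1].
have sMH := proper_sub (maxgroupp maxM).
have [a Ma leal] := IH (subset_trans sMH sHD).
have [sKM|nsKM] := boolP ('ker_H f \subset M).
  exists a.+1; first exact: unrefinableS (morphim_maximal_ker sHD maxM sKM) Ma.
  rewrite addSn ltnS (leq_trans _ leal) // leq_add2l.
  rewrite (_ : 'ker_H f = 'ker_M f) //; apply/eqP.
  by rewrite eqEsubset (setSI _ sMH) andbT subsetI sKM subsetIr.
exists a; last first.
  by rewrite -addn1 leq_add ?leq_b1 // (leq_trans _ leal) ?leq_addr.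
rewrite (_ : (f @* H)%G = (f @* M)%G) //.
by apply/val_inj/esym/morphim_maximal_mulker.
Qed.

(** Going down, the first term [M] that does not contain the kernel costs one step without changing
    the image. By hypothesis [M] still meets the kernel, so a second step is lost below [M]. *)
Lemma unrefinable_morphim2 H l :
    (forall L M : {group aT}, 'ker f \subset L -> L \subset H -> maximal M L ->
       'ker_M f != 1) ->
    unrefinable H l -> H \subset D -> 'ker f \subset H -> 'ker f != 1 ->
  exists2 a, unrefinable (f @* H) a & a + 2 <= l.
Proof.
move=> noC uH; elim: {H l}uH noC => [|M H l maxM uM IH] noC sHD sKH ntK.
  by case/negP: ntK; rewrite -subG1.
have sMH := proper_sub (maxgroupp maxM).
have sMD := subset_trans sMH sHD.
have eKH : 'ker_H f = 'ker f by rewrite (setIidPr sKH).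
have [sKM|nsKM] := boolP ('ker f \subset M).
  have [//|a Ma leal] := IH _ sMD sKM ntK.
    by move=> L M' sKL sLM; apply: noC; rewrite ?(subset_trans sLM).
  exists a.+1; last by rewrite addSn.
  by apply: unrefinableS Ma; apply: morphim_maximal_ker; rewrite ?eKH.
have [a Ma leal] := unrefinable_morphim uM sMD.
rewrite (noC H M) // in leal.
exists a; last by rewrite addnS ltnS.
rewrite (_ : (f @* H)%G = (f @* M)%G) //.
by apply/val_inj/esym/morphim_maximal_mulker; rewrite ?eKH.
Qed.

Lemma unrefinable_injm H l :
  'injm f -> H \subset D -> unrefinable H l -> unrefinable (f @* H) l.
Proof.
move=> injf sHD uH; elim: {H l}uH sHD => [_|M H l maxM _ IH sHD].
  by rewrite (_ : (f @* 1)%G = 1%G); [constructor | apply/val_inj/morphim1].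
have sMD := subset_trans (proper_sub (maxgroupp maxM)) sHD.
by apply: unrefinableS (IH sMD); rewrite injm_maximal.
Qed.

End MorphismJumps.

(** * The regular wreath product with a cyclic group *)

Section WreathType.

Variables (T : finGroupType) (m : nat).

(* The regular wreath product of T by the additive group of 'I_m.+1. *)
Record cwreath := CWreath { cwbase : {ffun 'I_m.+1 -> T}; cwtop : 'I_m.+1 }.

Definition cwreath_pair (w : cwreath) := (cwbase w, cwtop w).
Definition pair_cwreath u := CWreath u.1 u.2.
Lemma cwreath_pairK : cancel cwreath_pair pair_cwreath.
Proof. by case. Qed.

HB.instance Definition _ := Finite.copy cwreath (can_type cwreath_pairK).

(** The top part of [u] translates the coordinates of [v], so that conjugation by a shift by [a]
    carries coordinate [x] to [x + a]. *)
Definition cwreath_mul (u v : cwreath) :=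
  CWreath [ffun x => cwbase u x * cwbase v (x + cwtop u)%R]
          (cwtop u + cwtop v)%R.
Definition cwreath_one := CWreath [ffun=> 1] 0%R.

Definition cwreath_inv (u : cwreath) :=
  CWreath [ffun x => (cwbase u (x - cwtop u)%R)^-1] (- cwtop u)%R.

Lemma cwreath_mulA : associative cwreath_mul.
Proof.
move=> u v w; congr CWreath; last exact: GRing.addrA.
by apply/ffunP=> x; rewrite !ffunE mulgA GRing.addrA.
Qed.

Lemma cwreath_mul1 : left_id cwreath_one cwreath_mul.
Proof.
move=> [f a]; congr CWreath; last exact: GRing.add0r.
by apply/ffunP=> x; rewrite !ffunE mul1g GRing.addr0.
Qed.

Lemma cwreath_mulV : left_inverse cwreath_one cwreath_inv cwreath_mul.
Proof.
move=> [f a]; congr CWreath; last exact: GRing.addNr.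
by apply/ffunP=> x; rewrite !ffunE mulVg.
Qed.

HB.instance Definition _ :=
  Finite_isGroup.Build cwreath cwreath_mulA cwreath_mul1 cwreath_mulV.

Lemma cwtopM : {morph cwtop : u v / u * v}.
Proof. by []. Qed.

Lemma cwbaseM (u v : cwreath) x :
  cwbase (u * v) x = cwbase u x * cwbase v (x + cwtop u)%R.
Proof. by rewrite ffunE. Qed.

Lemma cwbaseV (u : cwreath) x : cwbase u^-1 x = (cwbase u (x - cwtop u)%R)^-1.
Proof. by rewrite ffunE. Qed.

Lemma cwbase1 x : cwbase (1 : cwreath) x = 1.
Proof. by rewrite ffunE. Qed.

Lemma cwreathP (u v : cwreath) :
  (forall x, cwbase u x = cwbase v x) -> cwtop u = cwtop v -> u = v.
Proof.
by case: u v => [f a] [g b] /= /ffunP-> ->.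
Qed.

Canonical cwtop_morphism := @Morphism _ _ setT cwtop (in2W cwtopM).

Lemma card_cwreath : #|[set: cwreath]| = (#|T| ^ m.+1 * m.+1)%N.
Proof.
have bij_pair : bijective cwreath_pair by exists pair_cwreath; case.
by rewrite cardsT (bij_eq_card bij_pair) card_prod card_ffun !card_ord.
Qed.

Lemma mem_ker_cwtop w : (w \in 'ker cwtop) = (cwtop w == 0%R).
Proof. by rewrite !inE. Qed.

Lemma card_ker_cwtop : #|'ker cwtop| = (#|T| ^ m.+1)%N.
Proof.
pose emb (f : {ffun 'I_m.+1 -> T}) := CWreath f 0%R.
have emb_inj : injective emb by move=> f g [].
have <- : emb @: [set: {ffun 'I_m.+1 -> T}] = 'ker cwtop.
  apply/setP=> w; rewrite mem_ker_cwtop; apply/imsetP/eqP=> [[f _ ->] // | w0].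
  by exists (cwbase w) => //; apply: cwreathP.
by rewrite card_imset // cardsT card_ffun card_ord.
Qed.

Definition cwdiag t := CWreath [ffun=> t] 0%R.

Lemma cwdiagM : {morph cwdiag : t u / t * u}.
Proof.
move=> t u; apply: cwreathP => [x|]; first by rewrite cwbaseM !ffunE.
by rewrite cwtopM /= [in RHS]/mul /= GRing.addr0.
Qed.

Canonical cwdiag_morphism := @Morphism _ _ setT cwdiag (in2W cwdiagM).

Definition cwshift a := CWreath [ffun=> 1] a.

Lemma cwshiftM : {morph cwshift : a b / a * b}.
Proof.
by move=> a b; apply: cwreathP => // x; rewrite cwbaseM !ffunE mul1g.
Qed.

Canonical cwshift_morphism := @Morphism _ _ setT cwshift (in2W cwshiftM).

Definition cwcoord x t := CWreath [ffun y => if y == x then t else 1] 0%R.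

Lemma cwcoordM x : {morph cwcoord x : t u / t * u}.
Proof.
move=> t u; apply: cwreathP => [y|].
  by rewrite cwbaseM !ffunE GRing.addr0; case: eqP; rewrite ?mulg1.
by rewrite cwtopM /= [in RHS]/mul /= GRing.addr0.
Qed.

Canonical cwcoord_morphism x :=
  @Morphism _ _ setT (cwcoord x) (in2W (cwcoordM x)).

Lemma injm_cwdiag : 'injm cwdiag.
Proof. by apply/injmP=> t u _ _ [/ffunP/(_ 0%R)]; rewrite !ffunE. Qed.

Lemma injm_cwshift : 'injm cwshift.
Proof. by apply/injmP=> a b _ _ []. Qed.

(** The top component is free: this is the direct product of the constant functions and the
    shifts. *)
Definition cwdiagonal :=
  [set w : cwreath | [forall x, cwbase w x == cwbase w 0%R]].

Lemma cwdiagonalP w :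
  reflect (forall x, cwbase w x = cwbase w 0%R) (w \in cwdiagonal).
Proof. by rewrite inE; apply: (iffP forallP) => h x; apply/eqP. Qed.

Lemma group_set_cwdiagonal : group_set cwdiagonal.
Proof.
apply/group_setP; split; first by apply/cwdiagonalP=> x; rewrite !cwbase1.
move=> u v /cwdiagonalP du /cwdiagonalP dv; apply/cwdiagonalP=> x.
by rewrite !cwbaseM du dv [in RHS]dv.
Qed.

Canonical cwdiagonal_group := Group group_set_cwdiagonal.

Lemma cwdiag_diagonal t : cwdiag t \in cwdiagonal.
Proof. by apply/cwdiagonalP=> x; rewrite !ffunE. Qed.

Lemma cwshift_diagonal a : cwshift a \in cwdiagonal.
Proof. by apply/cwdiagonalP=> x; rewrite !ffunE. Qed.

Lemma morphim_cwdiag : cwdiag @* setT = 'ker_cwdiagonal cwtop.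
Proof.
apply/setP=> w; rewrite inE mem_ker_cwtop.
apply/morphimP/andP=> [[t _ _ ->]|[]].
  by rewrite cwdiag_diagonal.
move/cwdiagonalP=> dw /eqP w0; exists (cwbase w 0%R); rewrite ?inE //.
by apply: cwreathP => // x; rewrite ffunE.
Qed.

Lemma cwbaseJ w a x : cwbase (w ^ cwshift a) x = cwbase w (x - a)%R.
Proof.
by rewrite !cwbaseM cwbaseV !ffunE mulg1 invg1 mul1g.
Qed.

Lemma cwcoordJ x t a : cwcoord x t ^ cwshift a = cwcoord (x + a)%R t.
Proof.
apply: cwreathP=> [y|].
  by rewrite cwbaseJ !ffunE GRing.subr_eq.
by rewrite !cwtopM /= /mul /= GRing.add0r GRing.addNr.
Qed.

Lemma mul_ker_shift w : w * cwshift (- cwtop w)%R \in 'ker cwtop.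
Proof. by rewrite mem_ker_cwtop cwtopM /= /mul /= GRing.subrr. Qed.

(** A base element is the product of its coordinates, assembled here along a list. *)
Lemma ker_cwtop_sub (H : {group cwreath}) :
  (forall x t, cwcoord x t \in H) -> 'ker cwtop \subset H.
Proof.
move=> Hc; apply/subsetP=> w; rewrite mem_ker_cwtop => /eqP w0.
suff Hs s :
  uniq s -> CWreath [ffun x => if x \in s then cwbase w x else 1] 0%R \in H.
  have := Hs _ (enum_uniq 'I_m.+1); congr (_ \in H); apply: cwreathP => // x.
  by rewrite ffunE mem_enum.
elim: s => [_|x s IHs /= /andP[x's /IHs Hs]].
  by rewrite (_ : CWreath _ _ = 1) ?group1 //; apply: cwreathP.
have := groupM (Hc x (cwbase w x)) Hs; congr (_ \in H); apply: cwreathP => [y|].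
  rewrite cwbaseM !ffunE GRing.addr0 inE; case: eqVneq => [->|_] /=.
    by rewrite (negPf x's) mulg1.
  by rewrite mul1g.
by rewrite cwtopM /= /mul /= GRing.addr0.
Qed.

Lemma cwtopJ (u v : cwreath) : cwtop u = 0%R -> cwtop (u ^ v) = 0%R.
Proof.
by move=> u0; rewrite (morphJ cwtop_morphism) ?inE //= u0; apply: conj1g.
Qed.

Lemma cwtopR (u v : cwreath) : cwtop u = 0%R -> cwtop [~ u, v] = 0%R.
Proof.
by move=> u0; rewrite (morphR cwtop_morphism) ?inE //= u0; apply: comm1g.
Qed.

End WreathType.

(** * Wreath products of a nonabelian simple group *)

Lemma simple_noncommuting (T : finGroupType) (t : T) :
  simple [set: T] -> ~~ abelian [set: T] -> t != 1 -> exists u, [~ t, u] != 1.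
Proof.
move=> /simpleP[_ simT] nabT nt1.
have [Z1|ZT] := simT _ (center_normal [set: T]%G); last first.
  by case/negP: nabT; apply/center_idP.
apply/existsP; apply: contraR nt1; rewrite negb_exists => /forallP cT.
rewrite -in_set1 -[[set 1]]Z1; apply/centerP; split; rewrite ?inE // => u _.
by apply/commgP; have := cT u; rewrite negbK.
Qed.

Section WreathSimple.

Variables (T : finGroupType) (m : nat).
Hypotheses (simT : simple [set: T]) (nabT : ~~ abelian [set: T]).
Local Notation W := (cwreath T m).
Local Notation N := ('ker (@cwtop T m)).
Implicit Types (H : {group W}) (x : 'I_m.+1).

Lemma simple_full (K : {group T}) :
  K :!=: 1 -> [set: T] \subset 'N(K) -> forall t, t \in K.
Proof.
move=> ntK nK t; have [_ /(_ K)] := simpleP _ simT.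
rewrite /normal subsetT nK => /(_ isT)[K1 | ->]; last by rewrite inE.
by rewrite K1 eqxx in ntK.
Qed.

(** A commutator with an element supported at one coordinate [x] isolates that coordinate.
    Simplicity then puts the whole factor at [x] into [H], and shifts carry it to every other
    coordinate. *)
Lemma ker_cwtop_normal_sub H w :
  [set: W] \subset 'N(H) -> w \in H -> w \in N -> w != 1 -> N \subset H.
Proof.
move=> nH Hw; rewrite mem_ker_cwtop => /eqP w0 nt_w.
have [x ntx]: exists x, cwbase w x != 1.
  apply/existsP; apply: contraR nt_w; rewrite negb_exists => /forallP w1.
  apply/eqP/cwreathP => // x; have := w1 x; rewrite negbK => /eqP->.
  by rewrite ffunE.
have [u ntu] := simple_noncommuting simT nabT ntx.
have Hc : [~ w, cwcoord x u] = cwcoord x [~ cwbase w x, u].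
  apply: cwreathP => [y|].
    rewrite /commg /conjg !(cwbaseM, cwbaseV, cwtopM) w0 /= !ffunE.
    rewrite !w0 ?GRing.oppr0 ?GRing.subr0 ?GRing.addr0.
    by case: eqVneq => [->|_]; rewrite // invg1 mul1g mulg1 mulVg.
  exact: cwtopR.
have nHw v : v \in 'N(H) by rewrite (subsetP nH) ?inE.
have Hx t : cwcoord x t \in H.
  suff : t \in cwcoord x @*^-1 H by rewrite !inE.
  apply: (simple_full (K := (cwcoord x @*^-1 H)%G)) => /=.
    apply/trivgPn; exists [~ cwbase w x, u] => //.
    by rewrite !inE /= -Hc commgEl groupMl ?groupV // memJ_norm.
  apply/subsetP=> v _; rewrite inE; apply/subsetP=> _ /imsetP[s Hs ->].
  rewrite !inE /= in Hs *; rewrite morphJ ?inE // memJ_norm //.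
apply: ker_cwtop_sub => y t.
have := Hx t; rewrite -(memJ_norm _ (nHw (cwshift T (y - x)%R))) cwcoordJ.
by rewrite GRing.addrC GRing.subrK.
Qed.

(** As [s] grows to all coordinates but one, these subgroups of [H] shrink to elements supported at
    a single coordinate. *)
Definition vanishing H (s : seq 'I_m.+1) :=
  [set w in 'ker_H (@cwtop T m) | all (fun x => cwbase w x == 1) s].

Lemma vanishingP H s w :
  reflect [/\ w \in H, cwtop w = 0%R & {in s, forall x, cwbase w x = 1}]
          (w \in vanishing H s).
Proof.
rewrite !inE /= -andbA; apply: (iffP and3P).
  by case=> Hw /eqP w0 /allP ws; split=> // x /ws/eqP.
by case=> Hw -> ws; split=> //; apply/allP=> x /ws ->.
Qed.

Lemma group_set_vanishing H s : group_set (vanishing H s).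
Proof.
apply/group_setP; split.
  by apply/vanishingP; split=> [||x _]; rewrite ?group1 ?cwbase1.
move=> u v /vanishingP[Hu u0 us] /vanishingP[Hv v0 vs].
apply/vanishingP; split=> [||x xs]; first exact: groupM.
  by rewrite cwtopM u0 v0 mulg1.
by rewrite cwbaseM u0 GRing.addr0 us // vs // mulg1.
Qed.

Canonical vanishing_group H s := Group (group_set_vanishing H s).

Definition cweval x (w : W) := cwbase w x.

Lemma cwevalM x : {in N &, {morph cweval x : u v / u * v}}.
Proof.
move=> u v /[!mem_ker_cwtop]/eqP u0 _.
by rewrite /cweval cwbaseM u0 GRing.addr0.
Qed.

Canonical cweval_morphism x := Morphism (@cwevalM x).

Lemma cwbaseR x (u v : W) :
    cwtop u = 0%R -> cwtop v = 0%R ->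
  cwbase [~ u, v] x = [~ cwbase u x, cwbase v x].
Proof.
move=> u0 v0; apply: (morphR (cweval_morphism x));
  by rewrite mem_ker_cwtop ?u0 ?v0.
Qed.

(** The values at [x] form a subgroup of [T]. It is normal, since conjugation by constant functions
    acts on each coordinate separately and preserves the value 1; being nontrivial, it is [T]. *)
Lemma vanishing_full H s x w :
    (forall t, cwdiag m t \in H) -> w \in vanishing H s -> cwbase w x != 1 ->
  forall t, exists2 v, v \in vanishing H s & cwbase v x = t.
Proof.
move=> Hd Vw ntw t.
have : t \in cweval x @* vanishing H s.
  apply: simple_full => /=.
    apply/trivgPn; exists (cwbase w x) => //.
    apply: (mem_morphim (cweval_morphism x)) => //.
    by case/vanishingP: Vw => _ w0 _; rewrite mem_ker_cwtop w0.
  apply/subsetP=> v _; rewrite inE.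
  apply/subsetP=> _ /imsetP[_ /morphimP[u Nu Vu ->] ->].
  have dJ y : cwbase (u ^ cwdiag m v) y = cwbase u y ^ v.
    rewrite /conjg !cwbaseM cwbaseV !ffunE /=.
    by rewrite GRing.oppr0 GRing.addr0.
  rewrite -dJ; apply: (mem_morphim (cweval_morphism x)).
    by rewrite memJ_norm // (subsetP (ker_norm _)) ?inE.
  case/vanishingP: Vu => Hu u0 us; apply/vanishingP; split=> [||y ys].
  - by rewrite groupJ.
  - exact: cwtopJ.
  - by rewrite dJ us // conj1g.
by case/morphimP=> v _ Vv ->; exists v.
Qed.

(** A larger subgroup [H] has base elements separating any two coordinates ([sep]). Commutators of
    such elements yield elements supported at one coordinate ([full]), so [H] contains the base
    group as well as the shifts. *)
Lemma cwdiagonal_maximal : prime m.+1 -> maximal (cwdiagonal T m) [set: W].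
Proof.
move=> p_pr; apply/maxgroupP; split=> [|H ltHW sDH].
  rewrite properE subsetT; have [nT1 _] := simpleP _ simT.
  have [t _ nt1] := trivgPn _ nT1.
  apply/negP=> /subsetP/(_ (cwcoord (ord_max : 'I_m.+1) t)).
  rewrite !inE => /(_ isT)/forallP/(_ ord_max); rewrite !ffunE eqxx.
  (* Coordinates 0 and [ord_max] differ because the prime [m.+1] is at least 2. *)
  suff /negPf-> : (0 : 'I_m.+1)%R != ord_max by rewrite (negPf nt1).
  by rewrite -val_eqE /= eq_sym -lt0n -ltnS prime_gt1.
have Hd t : cwdiag m t \in H by rewrite (subsetP sDH) ?cwdiag_diagonal.
have Hs a : cwshift T a \in H by rewrite (subsetP sDH) ?cwshift_diagonal.
apply/eqP; rewrite eqEsubset sDH andbT; apply/subsetP=> h Hh.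
apply/cwdiagonalP=> y; apply/eqP; apply: contraTT ltHW => ney.
(* Otherwise x and z agree on the base part of H; by shift invariance so do  *)
(* any two coordinates differing by a multiple of z - x, i.e., any two.      *)
have sep x z :
  x != z -> exists2 w, w \in vanishing H [::] & cwbase w x != cwbase w z.
  move=> nexz; apply/exists_inP; apply: contraR ney.
  rewrite negb_exists_in => /forall_inP eqH.
  pose k := h * cwshift T (- cwtop h)%R.
  have Hk : k \in H by rewrite groupM.
  have kb v : cwbase k v = cwbase h v by rewrite cwbaseM !ffunE mulg1.
  have k0 : cwtop k = 0%R by apply/eqP; rewrite -mem_ker_cwtop mul_ker_shift.
  pose d : 'I_m.+1 := (z - x)%R.
  have kd v : cwbase k (v * d) = cwbase k v.
    have := eqH (k ^ cwshift T (x - v)%R); rewrite negbK !cwbaseJ GRing.subKr.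
    have -> : (z - (x - v))%R = v * d.
      by rewrite /mul /= /d GRing.opprB GRing.addrCA.
    move/(_ _)/eqP/esym; apply.
    apply/vanishingP; split=> //; first by rewrite groupJ.
    exact: cwtopJ.
  have : y \in <[d]>.
    suff -> : <[d]> = setT by rewrite inE.
    have dvd : #[d] %| m.+1 by rewrite -[m.+1]card_ord -cardsT cardSg ?subsetT.
    have nd1 : #[d] != 1%N by rewrite order_eq1 [_ == _]GRing.subr_eq0 eq_sym.
    apply/eqP; rewrite eqEcard subsetT cardsT card_ord.
    by rewrite -/(#[d]) (prime_nt_dvdP p_pr nd1 dvd) leqnn.
  case/cycleP=> j ->; rewrite -!kb; apply/eqP.
  elim: j => [|j <-]; first by rewrite expg0.
  by rewrite expgSr kd.
(* To add [z] to [s], take the commutator of an element vanishing on [s] with one vanishing at [z].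
   It vanishes on both, and the values at [x] can be chosen not to commute. *)
have full x s :
  x \notin s -> forall t, exists2 v, v \in vanishing H s & cwbase v x = t.
  elim: s => [_ t|z s IHs].
    exists (cwdiag m t); last by rewrite ffunE.
    by apply/vanishingP; split.
  rewrite inE negb_or => /andP[nexz xs].
  have [w /vanishingP[Hw w0 _] new] := sep x z nexz.
  (* Dividing by the constant function with the value of [w] at [z] kills coordinate [z] but not
     [x]. *)
  have Vz : w * cwdiag m (cwbase w z)^-1 \in vanishing H [:: z].
    apply/vanishingP; split; first by rewrite groupM.
      by rewrite cwtopM w0 mulg1.
    by move=> v /[!inE]/eqP->; rewrite cwbaseM ffunE mulgV.
  have ntz : cwbase (w * cwdiag m (cwbase w z)^-1) x != 1.
    by rewrite cwbaseM ffunE -eq_mulgV1.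
  have [nT1 _] := simpleP _ simT; have [t _ nt1] := trivgPn _ nT1.
  have [u ntu] := simple_noncommuting simT nabT nt1.
  have [v Vv vx] := IHs xs t.
  have [v' Vv' v'x] := vanishing_full Hd Vz ntz u.
  apply: (@vanishing_full _ _ _ [~ v, v']) => //; last first.
    case/vanishingP: Vv => _ v0 _; case/vanishingP: Vv' => _ v'0 _.
    by rewrite cwbaseR // vx v'x.
  case/vanishingP: Vv => Hv v0 vs; case/vanishingP: Vv' => Hv' v'0 v's.
  apply/vanishingP; split=> [||a]; first by rewrite groupR.
    exact: cwtopR.
  rewrite inE cwbaseR // => /predU1P[->|/vs->]; last exact: comm1g.
  by rewrite v's ?inE // commg1.
have sNH : N \subset H.
  apply: ker_cwtop_sub => x t.
  have [|v /vanishingP[Hv v0 vx] <-] := full x (enum (predC1 x)) _ t.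
    by rewrite mem_enum inE eqxx.
  rewrite (_ : cwcoord _ _ = v) //; apply: cwreathP => // z; rewrite ffunE.
  by case: eqP => [->//|/eqP nezx]; rewrite vx // mem_enum.
suff -> : H :=: setT by rewrite properxx.
apply/eqP; rewrite eqEsubset subsetT; apply/subsetP=> w _.
by rewrite -(groupMr _ (Hs (- cwtop w)%R)) (subsetP sNH) // mul_ker_shift.
Qed.

End WreathSimple.

(** * Chief length modulo a minimal normal kernel *)

Section ChiefLength.

Variables (aT rT : finGroupType) (D : {group aT}) (f : {morphism D >-> rT}).

Lemma morphpre_chief_factor (V U : {group rT}) :
    chief_factor (f @* D) V U ->
  chief_factor D (f @*^-1 V) (f @*^-1 U).
Proof.
case/andP=> /maxgroupP[/andP[ltVU nVD] maxV] nsUD.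
have eD : f @*^-1 (f @* D) = D.
  by rewrite morphimGK ?(normal_sub (ker_normal f)).
have [sUD nUD] := andP nsUD; have sVU := proper_sub ltVU.
apply/andP; split; last by rewrite -[X in _ <| X]eD morphpre_normal.
apply/maxgroupP; split.
  rewrite morphpre_proper ?ltVU ?(subset_trans sVU) //=.
  by have := morphpre_norms f nVD; rewrite eD.
move=> L /andP[ltLU nLD] sVL.
have sLD : L \subset D := subset_trans (proper_sub ltLU) (subsetIl _ _).
have sLfD : f @* L \subset f @* D := morphimS f sLD.
have sKL : 'ker f \subset L.
  by apply: subset_trans sVL; rewrite morphpreS ?sub1G.
have eL : f @*^-1 (f @* L) = L by rewrite morphimGK.
rewrite -eL; congr (f @*^-1 _); apply: (maxV (f @* L)%G).
  by rewrite -(morphpre_proper (f := f)) //= eL ltLU morphim_norms.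
by rewrite -(morphpreK (subset_trans sVU sUD)) morphimS.
Qed.

(** The kernel is the first chief factor; the preimages of a chief series of the image supply the
    others. *)
Lemma chiefl_morphim : minnormal ('ker f) D -> chiefl D = (chiefl (f @* D)).+1.
Proof.
case/mingroupP=> /andP[ntK nKD] minK.
have eK : ('ker f)%G = (f @*^-1 1)%G by apply: val_inj.
rewrite [chiefl (f @* D)]/chiefl; case: chief_series_exists => s ch_s last_s /=.
rewrite (@chieflE _ D (('ker f)%G :: map (fun V => f @*^-1 V)%G s)).
  by rewrite /= size_map.
split=> /=; last first.
  rewrite eK last_map last_s; apply/val_inj.
  by rewrite /= morphimGK ?(normal_sub (ker_normal f)).
apply/andP; split.
  rewrite /chief_factor ker_normal andbT; apply/maxgroupP; split.
    by rewrite proper1G ntK norms1.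
  move=> L /andP[/andP[sLK ltLK] nLD] _; apply/eqP; apply: contraR ltLK => ntL.
  by rewrite (minK L) // ntL.
rewrite eK path_map; apply: sub_path ch_s => V U /=.
exact: morphpre_chief_factor.
Qed.

End ChiefLength.

(** * How a wreath factor changes the two lengths *)

Section WreathTimesGroup.

Variables (T gT : finGroupType) (m : nat).
Hypotheses (simT : simple [set: T]) (nabT : ~~ abelian [set: T]).
Hypothesis p_pr : prime m.+1.
Local Notation W := (cwreath T m).
Local Notation Y := (W * gT)%type.
Local Notation pi1 := (@fst W gT).

Definition cwtop1 (u : Y) : 'I_m.+1 * gT := (cwtop u.1, u.2).

Lemma cwtop1M : {morph cwtop1 : u v / u * v}.
Proof. by []. Qed.

Canonical cwtop1_morphism := @Morphism _ _ setT cwtop1 (in2W cwtop1M).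

Lemma mem_ker_cwtop1 (u : Y) :
  (u \in 'ker cwtop1) = (cwtop u.1 == 0%R) && (u.2 == 1).
Proof. by rewrite !inE. Qed.

Lemma ker_cwtop1 : 'ker cwtop1 = setX ('ker (@cwtop T m)) 1.
Proof.
by apply/setP=> u; rewrite mem_ker_cwtop1 [RHS]inE mem_ker_cwtop inE.
Qed.

Lemma card_ker_cwtop1 : #|'ker cwtop1| = (#|T| ^ m.+1)%N.
Proof. by rewrite ker_cwtop1 cardsX cards1 muln1 card_ker_cwtop. Qed.

Lemma simple_nontrivial : exists t : T, t != 1.
Proof. by have [/trivgPn[t _ nt1] _] := simpleP _ simT; exists t. Qed.

Lemma ker_cwtop1_nt : 'ker cwtop1 != 1.
Proof.
have [t nt1] := simple_nontrivial; apply/trivgPn; exists (cwdiag m t, 1).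
  by rewrite mem_ker_cwtop1 !eqxx.
apply: contra nt1 => /eqP[/ffunP/(_ 0%R)]; rewrite !ffunE => ->; exact: eqxx.
Qed.

Lemma morphim_cwtop1 : cwtop1 @* setT = setT.
Proof.
apply/eqP; rewrite eqEsubset subsetT; apply/subsetP=> -[a g] _.
apply/morphimP; exists (cwshift T a, g) => //; exact: in_setT.
Qed.

Lemma minnormal_ker_cwtop1 : minnormal ('ker cwtop1) setT.
Proof.
apply/mingroupP; split=> [|X /andP[ntX nX] sXK].
  by rewrite ker_cwtop1_nt ker_norm.
have [[w g] Xw ntw] := trivgPn _ ntX.
have := subsetP sXK _ Xw; rewrite mem_ker_cwtop1 /= => /andP[w0 /eqP g1].
rewrite {g}g1 in Xw ntw.
apply/eqP; rewrite eqEsubset sXK /=.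
have : 'ker (@cwtop T m) \subset (@pairg1 W gT) @*^-1 X.
  apply: (@ker_cwtop_normal_sub _ _ _ _ (@pairg1 W gT @*^-1 X)%G w) => //.
  - apply/subsetP=> v _; rewrite inE; apply/subsetP=> _ /imsetP[s Xs ->].
    rewrite !inE /= in Xs *; rewrite morphJ ?inE // memJ_norm //.
    by rewrite (subsetP nX) ?inE.
  - by rewrite !inE.
  - by rewrite mem_ker_cwtop.
  - by apply: contra ntw => /eqP->.
move/subsetP=> sNX; apply/subsetP=> -[v g].
rewrite mem_ker_cwtop1 /= => /andP[v0 /eqP->].
by have := sNX v; rewrite mem_ker_cwtop v0 !inE => /(_ isT).
Qed.

(** Two minimal normal kernels are factored out in turn: the base group, then the cyclic group of
    prime order on top. *)
Lemma chiefl_cwreath_prod : chiefl [set: Y]%G = (chiefl [set: gT]%G).+2.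
Proof.
rewrite (chiefl_morphim minnormal_ker_cwtop1).
rewrite (_ : (cwtop1 @* setT)%G = [set: 'I_m.+1 * gT]%G); last first.
  by apply/val_inj/morphim_cwtop1.
pose f2 := [morphism of @snd 'I_m.+1 gT].
have eK : 'ker f2 = setX setT 1 by apply/setP=> u; rewrite !inE.
have cK : #|'ker f2| = m.+1 by rewrite eK cardsX cards1 muln1 cardsT card_ord.
rewrite (@chiefl_morphim _ _ _ f2); last first.
  apply/mingroupP; split=> [|X /andP[ntX nX] sXK].
    by rewrite -cardG_gt1 cK prime_gt1 ?ker_norm.
  apply/eqP; rewrite eqEcard sXK cK.
  have := cardSg sXK; rewrite cK => /prime_nt_dvdP.
  by move=> -> //=; rewrite ?leqnn // -trivg_card1.
congr (chiefl _).+2; apply/val_inj => /=; apply/eqP; rewrite eqEsubset subsetT.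
apply/subsetP=> g _; apply/morphimP; exists (0%R, g) => //; exact: in_setT.
Qed.

Hypotheses (ltTp : #|T| < m.+1) (ltGT : #|gT| < #|T| ^ m.+1).

Lemma cwtop1_no_complement (L M : {group Y}) :
  'ker cwtop1 \subset L -> maximal M L -> 'ker_M cwtop1 != 1.
Proof.
move=> sKL maxM; apply/negP=> /eqP tiMK.
have sML := proper_sub (maxgroupp maxM).
pose C := (L :&: 'ker pi1)%G.
have nCL : L \subset 'N(C).
  by rewrite normsI ?normG // (subset_trans (subsetT _)) // ker_norm.
(* If [C] is not in [M], then [L] is the product of [M] with the kernel and also with [C]; comparing
   orders contradicts [ltGT]. *)
have [sCM|nsCM] := boolP (C \subset M); last first.
  have nsKM : ~~ ('ker cwtop1 \subset M).
    by apply: contra ker_cwtop1_nt => /setIidPr e; rewrite -e tiMK.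
  have cL1 : #|L| = (#|M| * #|T| ^ m.+1)%N.
    rewrite -card_ker_cwtop1 -TI_cardMg // (maximal_mulg maxM) //.
    by right; rewrite (subset_trans (subsetT _)) // ker_norm.
  have cL2 : #|L| <= #|M| * #|gT|.
    have nCM := subset_trans sML nCL.
    rewrite -(maximal_mulg maxM (subsetIl _ _) (or_intror nCM) nsCM).
    rewrite (leq_trans (dvdn_leq _ (dvdn_cardMg _ _))) ?muln_gt0 ?cardG_gt0 //.
    rewrite leq_pmul2l ?cardG_gt0 // -cardsT -[X in _ <= X]mul1n.
    rewrite -(cards1 (1 : W)) -cardsX.
    by apply/subset_leq_card/subsetP=> u; rewrite !inE andbT => /andP[_ /= u1].
  by rewrite cL1 leq_pmul2l ?cardG_gt0 // leqNgt ltGT in cL2.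
(* Since [C] lies in [M], the second component can be erased inside [M], leaving an element of the
   trivial intersection with the kernel. *)
have Kw w g : (w, g) \in M -> w \in 'ker (@cwtop T m) -> w = 1.
  move=> Mwg; rewrite mem_ker_cwtop => w0.
  have Kw : (w, 1) \in 'ker cwtop1 by rewrite mem_ker_cwtop1 w0 eqxx.
  have Eg : (1, g) = (w, 1)^-1 * (w, g).
    by congr pair; rewrite /= ?mulVg ?invg1 ?mul1g.
  have Cg : (1, g) \in C.
    rewrite inE; apply/andP; split; last by rewrite !inE /= eqxx.
    rewrite Eg groupM ?groupV //; first exact: (subsetP sKL).
    exact: (subsetP sML).
  have : (w, 1) \in 'ker_M cwtop1.
    rewrite inE Kw andbT -(groupMr _ (subsetP sCM _ Cg)).
    by rewrite (_ : _ * _ = (w, g)) //; congr pair; rewrite /= ?mulg1 ?mul1g.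
  by rewrite tiMK => /set1P[].
have pM : m.+1.-group (pi1 @* M).
  have cM : #|@cwtop T m @* (pi1 @* M)| = #|pi1 @* M|.
    rewrite card_morphim setTI -indexgI (_ : _ :&: _ = 1) ?indexg1 //.
    apply/trivgP/subsetP=> w /setIP[/morphimP[[v g] _ Mvg ->] /= Nv].
    by apply/set1P; apply: Kw Mvg Nv.
  rewrite /pgroup -cM (pnat_dvd _ (pnat_id p_pr)) //.
  by rewrite -[m.+1]card_ord -cardsT cardSg ?subsetT.
(* The index of the shifts is a power of the order of [T], which is prime to [m.+1] by [ltTp]. *)
have sylA : m.+1.-Sylow([set: W]) (@cwshift T m @* setT).
  have cA : #|@cwshift T m @* setT| = m.+1.
    by rewrite card_injm ?injm_cwshift ?subsetT // cardsT card_ord.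
  rewrite /pHall subsetT /pgroup cA pnat_id //= -divgS ?subsetT //.
  rewrite cA card_cwreath mulnK // pnatX p'natE // orbC -implyNb.
  apply/implyP=> _; apply: contraL ltTp => /dvdn_leq; rewrite -leqNgt; apply.
  by rewrite -cardsT cardG_gt0.
have [x _ sMA] := Sylow_Jsub sylA (subsetT _) pM.
have sAD : @cwshift T m @* setT \subset cwdiagonal T m.
  by apply/subsetP=> _ /morphimP[a _ _ ->]; apply: cwshift_diagonal.
pose E := (L :&: pi1 @*^-1 (cwdiagonal T m :^ x^-1))%G.
have sME : M \subset E.
  rewrite subsetI sML; apply/subsetP=> u Mu; rewrite !inE /=.
  rewrite mem_conjgV (subsetP sAD) // (subsetP sMA) // memJ_conjg.
  by rewrite (mem_morphim [morphism of pi1]) ?inE.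
have [t nt1] := simple_nontrivial.
(* By maximality [E] is [M] or [L]. The first would put a conjugate of a nontrivial constant
   function in [M], the second a nonconstant function in [cwdiagonal]. *)
have /maximal_eqP[_ /(_ E sME (subsetIl _ _))] : maximal_eq M L.
  by rewrite /maximal_eq maxM orbT.
case=> eE.
  pose w := cwdiag m t ^ x^-1.
  have w0 : cwtop w = 0%R by apply: cwtopJ.
  have Kw1 : (w, 1) \in 'ker cwtop1 by rewrite mem_ker_cwtop1 w0 !eqxx.
  have Mw : (w, 1) \in M.
    rewrite -eE inE (subsetP sKL) // !inE /= memJ_conjg.
    exact: cwdiag_diagonal.
  have : w == 1 by apply/eqP; apply: Kw Mw _; rewrite mem_ker_cwtop w0.
  rewrite conjg_eq1 => /eqP[/ffunP/(_ 0%R)]; rewrite !ffunE => t1.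
  by rewrite t1 eqxx in nt1.
pose w := cwcoord (ord_max : 'I_m.+1) t ^ x^-1.
have w0 : cwtop w = 0%R by apply: cwtopJ.
have : (w, 1) \in E by rewrite eE (subsetP sKL) // mem_ker_cwtop1 w0 !eqxx.
rewrite !inE /= => /andP[_]; rewrite memJ_conjg => /cwdiagonalP/(_ ord_max).
rewrite !ffunE eqxx.
suff /negPf-> : (0 : 'I_m.+1)%R != ord_max by move/eqP; rewrite (negPf nt1).
by rewrite -val_eqE /= eq_sym -lt0n -ltnS prime_gt1.
Qed.

(** The constant functions are the kernel of [cwtop] on [cwdiagonal], hence of prime index. *)
Lemma cwdiag_maximal : maximal (@cwdiag T m @* setT) (cwdiagonal T m).
Proof.
rewrite morphim_cwdiag p_index_maximal ?subsetIl //.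
rewrite indexgI; have := card_morphim [morphism of @cwtop T m] (cwdiagonal T m).
rewrite setTI => <-.
suff -> : @cwtop T m @* cwdiagonal T m = setT by rewrite cardsT card_ord.
apply/eqP; rewrite eqEsubset subsetT; apply/subsetP=> a _.
by apply/morphimP; exists (cwshift T a); rewrite ?in_setT ?cwshift_diagonal.
Qed.

Variable phi : {morphism [set: gT] >-> T}.
Hypothesis phi_onto : phi @* setT = setT.

Definition cwgraph (g : gT) : Y := (cwdiag m (phi g), g).
Lemma cwgraphM : {morph cwgraph : g h / g * h}.
Proof. by move=> g h; rewrite /cwgraph morphM ?inE // cwdiagM. Qed.
Canonical cwgraph_morphism := @Morphism _ _ setT cwgraph (in2W cwgraphM).

(** For [K] above the graph, the constants in [K] form a subgroup of [T] normalised by the image of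
    [phi], which is [T]. By simplicity it is trivial or full, and [K] is accordingly the graph or
    everything. *)
Lemma cwgraph_maximal :
  maximal (cwgraph @* setT) (pi1 @*^-1 (@cwdiag T m @* setT)).
Proof.
have sGP : cwgraph @* setT \subset pi1 @*^-1 (@cwdiag T m @* setT).
  by apply/subsetP=> _ /morphimP[g _ _ ->]; rewrite !inE /= mem_morphim ?inE.
have mem_graph w g : (w, g) \in cwgraph @* setT -> w = cwdiag m (phi g).
  by case/morphimP=> h _ _ [-> ->].
have [t nt1] := simple_nontrivial.
apply/maxgroupP; split.
  rewrite properE sGP; apply/subsetPn; exists (cwdiag m t, 1).
    by rewrite !inE /= mem_morphim ?inE.
  apply: contra nt1 => /mem_graph; rewrite morph1.
  by move/(injmP (injm_cwdiag T m))=> ->; rewrite ?in_setT.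
move=> K /andP[sKP nsPK] sGK.
have pairM : {morph (fun t : T => (cwdiag m t, 1) : Y) : s t / s * t}.
  by move=> r s; rewrite /= cwdiagM; congr pair; rewrite /= mulg1.
pose f := @Morphism _ _ setT _ (in2W pairM).
have Sf s : (s \in f @*^-1 K) = ((cwdiag m s, 1) \in K) by rewrite !inE.
have nS : [set: T] \subset 'N(f @*^-1 K).
  apply/subsetP=> s _; have : s \in phi @* setT by rewrite phi_onto inE.
  case/morphimP=> g _ _ ->.
  rewrite inE; apply/subsetP=> _ /imsetP[r Sr ->].
  rewrite Sf in Sr; rewrite Sf.
  have -> : (cwdiag m (r ^ phi g), 1) = (cwdiag m r, 1) ^ cwgraph g.
    congr pair; last exact: (esym (conj1g g)).
    exact: (morphJ (cwdiag_morphism T m) (in_setT r) (in_setT (phi g))).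
  by rewrite groupJ // (subsetP sGK) // mem_morphim ?inE.
have split_graph r g :
  (cwdiag m r, g) = (cwdiag m (r * (phi g)^-1), 1) * cwgraph g.
  by congr pair; rewrite /= ?mul1g // -cwdiagM mulgKV.
have Kg g : cwgraph g \in K by rewrite (subsetP sGK) // mem_morphim ?inE.
have [S1|ntS] := eqVneq (f @*^-1 K) 1; last first.
  case/negP: nsPK; apply/subsetP=> -[w g].
  rewrite !inE /= => /morphimP[r _ _ ->].
  by rewrite split_graph groupM // -Sf (simple_full simT ntS nS).
apply/eqP; rewrite eqEsubset sGK andbT; apply/subsetP=> -[w g] Kwg.
have := subsetP sKP _ Kwg; rewrite !inE /= => /morphimP[r _ _ ew].
rewrite {w}ew in Kwg *; move: Kwg.
rewrite split_graph groupMr // -Sf S1 => /set1P ->.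
by rewrite (_ : (cwdiag m 1, 1) = 1) ?mul1g ?mem_morphim ?inE.
Qed.

Lemma unrefinable_cwreath_prod l :
  unrefinable [set: gT]%G l -> unrefinable [set: Y]%G l.+3.
Proof.
move=> ul.
have onto1 (A : {set W}) : A \subset pi1 @* setT.
  by apply/subsetP=> w _; apply/morphimP; exists (w, 1); rewrite ?inE.
apply: (@unrefinableS _ (pi1 @*^-1 (cwdiagonal T m))%G).
  have eY : [set: Y] = pi1 @*^-1 setT by apply/setP=> u; rewrite !inE.
  rewrite /= [X in maximal _ X]eY morphpre_maximal //.
  exact: cwdiagonal_maximal.
apply: (@unrefinableS _ (pi1 @*^-1 (@cwdiag T m @* setT))%G).
  by rewrite /= morphpre_maximal //; apply: cwdiag_maximal.
apply: (@unrefinableS _ (cwgraph @* setT)%G); first exact: cwgraph_maximal.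
apply: unrefinable_injm => //.
by apply/injmP=> g h _ _ [].
Qed.

(** For the lower bound, [cwtop1] loses at least two steps of a chain, and the projection [f2]
    killing the cyclic group loses at least one more. *)
Lemma minmaxl_cwreath_prod : minmaxl [set: Y]%G = (minmaxl [set: gT]%G).+3.
Proof.
apply/eqP; rewrite eqn_leq minmaxl_min /=; last first.
  exact: unrefinable_cwreath_prod (minmaxl_unrefinable _).
have noC (L M : {group Y}) : 'ker cwtop1 \subset L -> L \subset setT ->
    maximal M L -> 'ker_M cwtop1 != 1.
  by move=> sKL _; apply: cwtop1_no_complement.
have [a ua lea] := unrefinable_morphim2 noC (minmaxl_unrefinable [set: Y]%G)
  (subxx _) (subsetT _) ker_cwtop1_nt.
apply: leq_trans lea; rewrite addn2 !ltnS.
have {}ua : unrefinable [set: 'I_m.+1 * gT]%G a.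
  rewrite (_ : [set: _]%G = (cwtop1 @* setT)%G) //.
  by apply: group_inj; rewrite /= morphim_cwtop1.
pose f2 := [morphism of @snd 'I_m.+1 gT].
have [b ub] := unrefinable_morphim f2 ua (subxx _).
rewrite setTI.
have -> : 'ker f2 != 1.
  apply/trivgPn; exists (ord_max, 1); first by rewrite !inE eqxx.
  by apply/eqP=> -[m0]; move: p_pr; rewrite m0.
rewrite addn1; apply: leq_ltn_trans; apply: minmaxl_min.
rewrite (_ : [set: gT]%G = (f2 @* setT)%G) //.
apply: group_inj; apply/esym/eqP; rewrite eqEsubset subsetT.
apply/subsetP=> g _; by apply/morphimP; exists (0%R, g); rewrite ?inE.
Qed.

End WreathTimesGroup.

(** * Iterating the construction *)

Section Family.

Variable T : finGroupType.
Hypotheses (simT : simple [set: T]) (nabT : ~~ abelian [set: T]).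

Lemma chiefl_simple : chiefl [set: T]%G = 1%N.
Proof.
rewrite (@chieflE _ _ [:: [set: T]%G]) //; split=> //=.
by rewrite /chief_factor normal_refl andbT -simple_maxnormal simT.
Qed.

(** The surjection [phi] is carried through the induction because the next step needs its graph. *)
Lemma exists_minmaxl_chiefl (k : nat) :
  exists (gT : finGroupType) (phi : {morphism [set: gT] >-> T}),
    [/\ phi @* setT = setT, minmaxl [set: gT]%G = (minmaxl [set: T]%G + 3 * k)%N
      & chiefl [set: gT]%G = (1 + 2 * k)%N].
Proof.
elim: k => [|k [gT [phi [onto eqm eqc]]]].
  exists T, (idm_morphism [set: T]); split; last exact: chiefl_simple.
    exact: morphim_idm.
  by rewrite muln0 addn0.
(* Exceeding the order of [gT] suffices for [ltGT], since [p] is less than the [p]-th power of the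
   order of [T]. *)
have [p] := prime_above (maxn #|T| #|gT|).
rewrite gtn_max => /andP[ltTp ltGp] p_pr.
have T1 : 1 < #|T|.
  by rewrite -cardsT cardG_gt1; have [] := simpleP _ simT.
have ltG := ltn_trans ltGp (ltn_expl p T1).
case: p p_pr ltTp {ltGp} ltG => // m p_pr ltTp ltG.
exists (cwreath T m * gT)%type.
have phiM : {morph (fun u : cwreath T m * gT => phi u.2) : u v / u * v}.
  by move=> u v; rewrite /= morphM ?inE.
exists (@Morphism _ _ setT _ (in2W phiM)); split.
- apply/eqP; rewrite eqEsubset subsetT; apply/subsetP=> t.
  rewrite -onto => /morphimP[g _ _ ->]; apply/morphimP.
  by exists (1, g); rewrite ?inE.
- rewrite (minmaxl_cwreath_prod simT nabT p_pr ltTp ltG onto) eqm.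
  by rewrite mulnS addnCA add3n.
- by rewrite (chiefl_cwreath_prod gT simT nabT p_pr) eqc mulnS.
Qed.

End Family.

(** * The alternating group of degree 5 and the conclusion *)

(** The chain consists of the stabilisers of one and of two points, of orders 12 and 3. The first
    two steps are maximal because 2-transitive actions are primitive, the last because 3 is
    prime. *)
Lemma unrefinable_Alt5 (X : finType) : #|X| = 5 -> unrefinable 'Alt_X 3.
Proof.
move=> cX; have /card_gt0P[x _] : 0 < #|X| by rewrite cX.
have cA : #|'Alt_X| = 60 by apply: double_inj; rewrite -mul2n card_Alt cX.
have tr3 : [transitive^3 'Alt_X, on setT | 'P].
  by have := Alt_trans X; rewrite cX.
have tr2 := stab_ntransitive (isT : 0 < 2) (in_setT x) tr3.
have tr1 := ntransitive1 (isT : 0 < 3) tr3.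
have cS : #|[set: X] :\ x| = 4.
  by have := cardsD1 x [set: X]; rewrite cardsT cX in_setT => -[].
have /card_gt0P[y Sy] : 0 < #|[set: X] :\ x| by rewrite cS.
have tr21 := ntransitive1 (isT : 0 < 2) tr2.
pose B := 'C_('Alt_X)[x | 'P]%G; pose C := 'C_B[y | 'P]%G.
have cB : #|B| = 12.
  have := card_orbit_stab 'P 'Alt_X x.
  rewrite (atransP tr1) ?inE // cardsT cX cA => /eqP.
  by rewrite -[60]/(5 * 12)%N eqn_pmul2l // => /eqP.
have cC : #|C| = 3.
  have := card_orbit_stab 'P B y.
  rewrite (atransP tr21) // cS cB => /eqP.
  by rewrite -[12]/(4 * 3)%N eqn_pmul2l // => /eqP.
have maxB : maximal B 'Alt_X.
  have := ntransitive_primitive (isT : 1 < 3) tr3.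
  rewrite (trans_prim_astab (in_setT x) tr1) => /orP[/eqP e|//].
  by have := cA; rewrite -e cB.
have maxC : maximal C B.
  have := ntransitive_primitive (isT : 1 < 2) tr2.
  rewrite (trans_prim_astab Sy tr21) => /orP[/eqP e|//].
  by have := cB; rewrite -e cC.
have max1 : maximal 1 C by rewrite p_index_maximal ?sub1G // indexg1 cC.
apply: (unrefinableS maxB); apply: (unrefinableS maxC).
by apply: unrefinableS max1 _; apply: unrefinable1.
Qed.

Theorem theorem5p4 (n : nat) (hn : (2 <= n)%N) :
  exists (gT : finGroupType) (G : {group gT}),
    ((minmaxl G)%:Z - (chiefl G)%:Z)%R = n%:Z%R.
Proof.
have c5 := card_ord 5.
pose T : finGroupType := [subg 'Alt_('I_5)]%type.
have isoT : [set: T] \isog 'Alt_('I_5) by rewrite isog_sym isog_subg.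
have simT : simple [set: T] by rewrite (isog_simple isoT) simple_Alt5 ?c5.
have nabT : ~~ abelian [set: T].
  have := @solvable_AltF 'I_5; rewrite c5 (isog_abelian isoT) => /(_ isT).
  by apply: contraFN => /abelian_sol.
have le3 : minmaxl [set: T]%G <= 3.
  apply: minmaxl_min.
  have := unrefinable_Alt5 c5.
  move/(unrefinable_injm (injm_subg 'Alt_('I_5)) (subxx _)).
  rewrite (_ : (subg _ @* _)%G = [set: T]%G) //.
  by apply: group_inj; apply: im_subg.
(* After [k] steps the difference is [minmaxl T - 1 + k], which is [n] for this [k]; the truncated
   subtraction is exact since [minmaxl T <= 3 <= n + 1]. *)
have [gT [_ [_ em ec]]] :=
  exists_minmaxl_chiefl simT nabT (n.+1 - minmaxl [set: T]%G).
exists gT, [set: gT]%G.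
have := subnK (leq_trans le3 (hn : 3 <= n.+1)).
move: (n.+1 - _)%N em ec => k em ec ek.
apply/eqP; rewrite GRing.subr_eq -PoszD eqz_nat em ec.
by rewrite addnA addn1 -ek (mulSn 2) addnA [(minmaxl _ + k)%N]addnC.
Qed.
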